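(* Let $\lambda\in(0,\infty)$, $p_n=\lambda/n$, let $G_n$ be the Erdős–Rényi random graph $G(n,p_n)$, and let $a\in(0,1)$. There is a constant $C$, independent of $\varepsilon$ (and of $n$), such that for any $\varepsilon>0$ and all sufficiently large $n$, $$\mathbb{P}\big(\mathrm{DT}_n(G_n)\le\tfrac13(a-\varepsilon)n\,\big|\,V_T(G_n)\ge an\big)\le\exp\left(-\tfrac16\varepsilon n\log n+Cn\right).$$
   Context: $G(n,p)$ is the random simple graph on vertex set $[n]=\{1,\dots,n\}$ in which each possible edge is present independently with probability $p$. For a graph $G$, $V_T(G)$ is the number of vertices of $G$ that belong to at least one triangle of $G$, and $\mathrm{DT}_n(G)$ is the maximum number of pairwise vertex-disjoint triangles in $G$. *)

(* Defs.v *)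
From mathcomp Require Import all_boot all_order all_algebra.
From mathcomp Require Import reals.

Set Implicit Arguments.
Unset Strict Implicit.
Unset Printing Implicit Defensive.

Import Order.TTheory GRing.Theory Num.Theory.
Local Open Scope ring_scope.

Definition edge (n : nat) : Type := {e : {set 'I_n} | #|e| == 2}.

(* A simple graph on the n vertices of 'I_n is its set of edges, an arbitrary
   set of two-element sets of vertices. *)
Notation graph n := {set edge n}.

Definition triangles (n : nat) (G : graph n) : {set {set 'I_n}} :=
  [set T : {set 'I_n} | (#|T| == 3) &&
     [forall e : edge n, (val e \subset T) ==> (e \in G)]].

Definition VT (n : nat) (G : graph n) : nat :=
  #|[set v : 'I_n | [exists T in triangles G, v \in T]]|.

Definition DT (n : nat) (G : graph n) : nat :=
  \max_(P : {set {set 'I_n}} | (P \subset triangles G) && trivIset P) #|P|.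

Section ErdosRenyi.
Variables (R : realType) (n : nat) (p : R).

(* The law of G(n,p); it is a probability only for 0 <= p <= 1. *)
Definition Gnp_mass (G : graph n) : R :=
  \prod_(e : edge n) (if e \in G then p else 1 - p).

Definition Gnp_prob (A : {set graph n}) : R := \sum_(G in A) Gnp_mass G.

Definition Gnp_cond_prob (A B : {set graph n}) : R :=
  Gnp_prob (A :&: B) / Gnp_prob B.

(* The edges are present independently of each other, each with
   probability p. *)
Lemma Gnp_prob_indep (F F' : graph n) : [disjoint F & F'] ->
  Gnp_prob [set G : graph n | (F \subset G) && [disjoint F' & G]] =
  p ^+ #|F| * (1 - p) ^+ #|F'|.
Proof.
move=> dFF'.
pose w (e : edge n) (b : bool) : R :=
  if b then (if e \in F' then 0 else p) else (if e \in F then 0 else 1 - p).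
transitivity (\prod_(e : edge n) \sum_(b : bool) w e b).
  rewrite bigA_distr_bigA /= /Gnp_prob.
  rewrite (reindex (fun f : {ffun edge n -> bool} => [set e | f e])) /=; last first.
    exists (fun G : graph n => [ffun e => e \in G]) => [f _|G _].
      by apply/ffunP=> e; rewrite ffunE inE.
    by apply/setP=> e; rewrite inE ffunE.
  rewrite [LHS]big_mkcond /=; apply: eq_bigr => f _; rewrite inE.
  case: ifPn => [/andP[/subsetP FG /pred0P F'G]|].
    rewrite /Gnp_mass; apply: eq_bigr => e _; rewrite inE /w.
    have := FG e; have := F'G e; rewrite /= !inE.
    by case: (f e); case: (e \in F); case: (e \in F') => // _ /(_ isT).
  rewrite negb_and => /orP[/subsetPn[e eF]|/pred0Pn[e /andP[eF' ]]].
    by rewrite [e \in _]inE => /negbTE fe; rewrite (bigD1 e) //= /w fe eF mul0r.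
  rewrite /= in eF' *; rewrite inE => fe.
  by rewrite (bigD1 e) //= /w fe eF' mul0r.
rewrite -!prodr_const [X in _ = X * _]big_mkcond [X in _ = _ * X]big_mkcond.
rewrite -big_split /=.
apply: eq_bigr => e _; rewrite big_bool /w.
have := pred0P dFF' e; rewrite /=.
case: (e \in F); case: (e \in F') => //= _.
- by rewrite addr0 mulr1.
- by rewrite add0r mul1r.
- by rewrite addrC subrK mulr1.
Qed.

Lemma Gnp_prob_setT : Gnp_prob setT = 1.
Proof.
have dE : [disjoint (set0 : graph n) & (set0 : graph n)].
  by rewrite -setI_eq0 setI0.
have := Gnp_prob_indep dE; rewrite !cards0 !expr0 mulr1 => <-.
by congr Gnp_prob; apply/setP=> G; rewrite !inE sub0set -setI_eq0 set0I eqxx.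
Qed.

End ErdosRenyi.

(* Main.v *)
Require Import Defs.
From mathcomp Require Import all_boot all_order all_algebra all_fingroup.
From mathcomp Require Import reals sequences exp.
From mathcomp Require Import zify ring lra.

Import Order.TTheory GRing.Theory Num.Theory.
Local Open Scope ring_scope.

(** Covering [k] vertices by triangles has a price of [1/n] per triangle used,
    up to factors exponential in [n], and this is why a graph prefers disjoint
    triangles: those cover three vertices each.

    Upper bound for the joint event.  Take a minimal family [P] of triangles
    covering all the vertices that lie in triangles.  By minimality each
    triangle of [P] has a private vertex, its apex; call the opposite edge its
    spine.  Two triangles of [P] can share an edge only if they have the same
    spine, and spines avoid the apexes, so the union of [P] is a family of
    books: with [t] triangles and [q] different spines it has [2t + q] edges.
    To name such a family one writes down, for one apex per spine, the two ends
    of the spine ([n^2] possibilities), and for every other apex which apex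
    shares its spine ([n] possibilities).  That makes about [n^(t+q)] families,
    each present with probability [(lambda/n)^(2t+q)], whence [n^-t]
    ([Gnp_prob_books_le]).  A maximal disjoint subfamily of [P] has at most [DT]
    members and every other triangle of [P] adds at most two vertices, so
    [VT <= 2t + DT] ([card_cover_le_DT]).  If [VT >= a n] and
    [DT <= (a - eps) n / 3] then [t >= (a/3 + eps/6) n].

    Lower bound for the conditioning event.  Let [m] be about [a n / 3]; there are
    [m!^2] graphs made of [m] disjoint triangles joining three fixed blocks of [m]
    vertices along two bijections.  Each is the whole of [G(n,p)] with
    probability at least [p^(3m) (1-p)^(n^2)], which gives [n^(2m-3m)], that is
    [exp(- (a/3) n ln n)], up to an exponential factor ([Gnp_prob_VT_lower]).

    The quotient of the two bounds leaves [exp(- (eps/6) n ln n + C n)], and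
    neither exponential factor depends on [eps]. *)

(** * Covers by triangles and books *)

Section Combinatorics.
Local Open Scope nat_scope.
Variable n : nat.
Implicit Types (G : graph n) (P Q : {set {set 'I_n}}) (S T : {set 'I_n}).
Implicit Types (b : 'I_n -> {set 'I_n}).

Lemma VT_cover G : VT G = #|cover (triangles G)|.
Proof.
congr #|pred_of_set _|; apply/setP=> v; rewrite inE.
by apply/exists_inP/bigcupP => -[T]; exists T.
Qed.

Lemma trianglesP G T :
  reflect (#|T| = 3 /\ forall e : edge n, val e \subset T -> e \in G)
    (T \in triangles G).
Proof.
rewrite inE; apply: (iffP andP) => [[/eqP-> /forall_inP]|[-> sG]] //.
by split=> //; apply/forall_inP.
Qed.

(** In a maximal disjoint subfamily [Q] of [P] the triangles account for three
    vertices each, while by maximality every triangle of [P] outside [Q] meets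
    the vertices of [Q] and adds at most two new ones; so the total is at most
    [3 |Q| + 2 (|P| - |Q|)]. *)
Lemma card_cover_le_DT G P : P \subset triangles G ->
  #|cover P| <= 2 * #|P| + DT G.
Proof.
move=> sPG.
have cardT T : T \in P -> #|T| = 3 by move/(subsetP sPG)/trianglesP => [].
pose disj Q := (Q \subset P) && trivIset Q.
have disj0 : disj set0.
  by rewrite /disj sub0set; apply/trivIsetP=> A B; rewrite inE.
have [Q /maxsetP[/andP[sQP tQ] maxQ] _] := maxset_exists disj0.
have QDT : #|Q| <= DT G.
  by apply: leq_bigmax_cond; rewrite tQ (subset_trans sQP).
have coverQ : #|cover Q| <= 3 * #|Q|.
  apply: leq_trans (leq_card_cover Q) _; rewrite mulnC -sum_nat_const.
  by apply: leq_sum => T /(subsetP sQP)/cardT->.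
have meetQ T : T \in P :\: Q -> #|T :\: cover Q| <= 2.
  rewrite inE => /andP[TQ TP].
  have : ~~ [disjoint T & cover Q].
    apply: contra TQ => dTQ.
    suff <- : T |: Q = Q by rewrite setU11.
    apply: maxQ (subsetUr _ _); rewrite /disj subUset sub1set TP sQP /=.
    apply/trivIsetP => A B /setU1P[->|AQ] /setU1P[->|BQ]; rewrite ?eqxx //.
    - move=> _; apply: disjointWr dTQ; exact: (bigcup_max B).
    - move=> _; rewrite disjoint_sym; apply: disjointWr dTQ.
      exact: (bigcup_max A).
    - exact: (trivIsetP tQ).
  rewrite -setI_eq0 -card_gt0 => I0.
  by have := cardsID (cover Q) T; rewrite (cardT T TP); lia.
have sub : cover P \subset cover Q :|: \bigcup_(T in P :\: Q) (T :\: cover Q).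
  apply/subsetP=> v /bigcupP[T TP vT]; rewrite inE.
  case: (boolP (v \in cover Q)) => //= vQ; apply/bigcupP; exists T.
    by rewrite inE TP andbT; apply: contra vQ => TQ; apply/bigcupP; exists T.
  by rewrite inE vQ.
have rest : #|\bigcup_(T in P :\: Q) (T :\: cover Q)| <= 2 * #|P :\: Q|.
  rewrite mulnC -sum_nat_const.
  elim/big_rec2: _ => [|T k U TPQ IH]; first by rewrite cards0.
  by rewrite (leq_trans (leq_card_setU _ _)) // leq_add // meetQ.
have := leq_trans (subset_leq_card sub) (leq_card_setU _ _).
have := cardsID Q P; rewrite (setIidPr sQP); lia.
Qed.

(** The triangles [v |: b v] for [v] in [S], seen as a set of edges; triangles
    with the same spine [b v] are the pages of one book. *)
Definition books S b : {set edge n} :=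
  [set e | [exists v in S,
     (val e == b v) || [exists u in b v, val e == [set v; u]]]].

Lemma set2_apex_inj S (v u v' u' : 'I_n) : v \in S -> v' \in S ->
  u \notin S -> u' \notin S -> [set v; u] = [set v'; u'] -> (v, u) = (v', u').
Proof.
move=> vS v'S uS u'S E.
have ev : v = v'.
  have : v \in [set v'; u'] by rewrite -E set21.
  by case/set2P=> // vu; rewrite -vu vS in u'S.
rewrite ev; congr pair.
have : u \in [set v'; u'] by rewrite -E set22.
by case/set2P=> // uv; rewrite uv v'S in uS.
Qed.

Definition spine_family S b :=
  forall v, v \in S -> #|b v| = 2 /\ [disjoint b v & S].

(** As spines avoid [S], an edge from an apex to its spine has exactly one end
    in [S], so it determines its apex and is never itself a spine. *)
Lemma card_books S b : spine_family S b ->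
  2 * #|S| + #|b @: S| <= #|books S b|.
Proof.
move=> bS.
pose X := [set x : 'I_n * 'I_n | (x.1 \in S) && (x.2 \in b x.1)].
pose pg (x : 'I_n * 'I_n) := [set x.1; x.2].
have notS v u : v \in S -> u \in b v -> u \notin S.
  by move=> /bS[_ d] ub; rewrite (disjointFr d).
have cardX : #|X| = 2 * #|S|.
  rewrite -sum1_card (eq_bigl (fun x => (x.1 \in S) && (x.2 \in b x.1))); last first.
    by move=> x; rewrite inE.
  rewrite -(pair_big_dep (mem S) (fun v u => u \in b v) (fun _ _ => 1)) /=.
  rewrite mulnC -sum_nat_const; apply: eq_bigr => v vS.
  by rewrite sum1_card; case: (bS v vS).
have cardPg : #|pg @: X| = 2 * #|S|.
  rewrite card_in_imset // => -[v u] [v' u']; rewrite !inE /= => /andP[vS ub].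
  case/andP=> v'S u'b; have uS := notS v u vS ub.
  have u'S := notS v' u' v'S u'b; exact: set2_apex_inj vS v'S uS u'S.
have dis : (pg @: X) :&: (b @: S) = set0.
  apply/setP=> B; rewrite !inE; apply/negP=> /andP[/imsetP[[v u]]].
  rewrite inE /= => /andP[vS ub] -> /imsetP[v' v'S] E.
  by have := notS v' v v'S; rewrite -E /pg /= set21 vS => /(_ isT).
have cardU : #|pg @: X :|: b @: S| = 2 * #|S| + #|b @: S|.
  by rewrite cardsU dis cards0 subn0 cardPg.
rewrite -cardU -(card_imset (books S b) val_inj); apply: subset_leq_card.
apply/subsetP=> B /setUP[/imsetP[[v u]]|/imsetP[v vS ->]].
  rewrite inE /= => /andP[vS ub] ->.
  have c2 : #|pg (v, u)| == 2.
    rewrite cards2 /=; case: (eqVneq v u) => // vu.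
    by move: (notS v u vS ub); rewrite -vu vS.
  apply/imsetP; exists (exist (fun e : {set 'I_n} => #|e| == 2) _ c2) => //.
  rewrite inE; apply/exists_inP; exists v => //=.
  by apply/orP; right; apply/exists_inP; exists u.
have c2 : #|b v| == 2 by case: (bS v vS) => ->.
apply/imsetP; exists (exist (fun e : {set 'I_n} => #|e| == 2) _ c2) => //.
rewrite inE; apply/exists_inP; exists v => //=.
by rewrite eqxx.
Qed.

(** The books are the union of a minimal cover of the triangle vertices by
    triangles, [S] is a choice of one private vertex in each triangle, and [b v]
    is the edge opposite to [v] in the triangle of [v]. *)
Lemma exists_books G : exists S b,
  [/\ spine_family S b, books S b \subset G & VT G <= 2 * #|S| + DT G].
Proof.
(* Minimality of the cover is what provides the private vertices. *)
pose full P := cover (triangles G) \subset cover P.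
have full0 : full (triangles G) by rewrite /full.
have [P /minsetP[fullP minP] sPG] := minset_exists full0.
pose private T v := (v \in T) && (v \notin cover (P :\ T)).
have privateP T : T \in P -> exists v, private T v.
  move=> TP; apply/existsP; apply: contraT; rewrite negb_exists => /forallP noT.
  have : P :\ T = P.
    apply: minP (subD1set _ _); apply/subsetP => v /(subsetP fullP)/bigcupP[U UP vU].
    case: (eqVneq U T) => [eU|neU].
      by move: (noT v); rewrite /private -eU vU /= negbK.
    by apply/bigcupP; exists U; rewrite // !inE neU.
  by move/setP/(_ T); rewrite !inE eqxx TP.
pose ap T := [pick v | private T v].
have apP T : T \in P -> exists2 v, ap T = Some v & private T v.
  move=> /privateP[v pv]; rewrite /ap; case: pickP => [w pw|/(_ v)].
    by exists w.
  by rewrite pv.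
have uniqT T v U : U \in P -> v \in U -> private T v -> U = T.
  move=> UP vU /andP[_ nc]; apply/eqP; apply: contraNT nc => neU.
  by apply/bigcupP; exists U; rewrite // !inE neU.
pose own v := odflt set0 [pick T in P | v \in T].
have ownP T v : T \in P -> private T v -> own v = T.
  move=> TP pv; rewrite /own; case: pickP => [U /andP[UP vU]|/(_ T)] /=.
    exact: uniqT pv.
  by rewrite TP; case/andP: pv => ->.
pose S := [set v | [exists T in P, ap T == Some v]].
have SP v : v \in S -> exists T, [/\ T \in P, private T v, ap T = Some v & own v = T].
  rewrite inE => /exists_inP[T TP /eqP apT]; exists T.
  split=> //; last apply: ownP => //.
    by have [w] := apP T TP; rewrite apT => -[<-].
  by have [w] := apP T TP; rewrite apT => -[<-].
have cardS : #|P| = #|S|.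
  apply/eqP; rewrite eqn_leq; apply/andP; split; last first.
    rewrite -(card_in_imset (f := own) (D := S)).
      by apply/subset_leq_card/subsetP => _ /imsetP[v /SP[T [TP _ _ ->]] ->].
    move=> v w /SP[T [_ _ aT ->]] /SP[U [_ _ aU ->]] eTU.
    by move: aT; rewrite eTU aU => -[].
  apply: leq_trans (leq_imset_card own S); apply/subset_leq_card/subsetP => T TP.
  have [v aT pv] := apP T TP; apply/imsetP; exists v; last by rewrite (ownP T).
  by rewrite inE; apply/exists_inP; exists T; rewrite // aT.
exists S, (fun v => own v :\ v); split.
- move=> v vS; have [T [TP pv aT ->]] := SP v vS; split.
    have /trianglesP[c3 _] := subsetP sPG T TP.
    by have := cardsD1 v T; have /andP[-> _] := pv; rewrite c3 add1n => -[<-].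
  rewrite disjoint_subset; apply/subsetP=> u; rewrite !inE => /andP[uv uT].
  apply: contra uv => uS.
  have [U [UP pu aU _]] : exists U, [/\ U \in P, private U u, ap U = Some u & own u = U].
    by apply: SP; rewrite inE.
  by move: aU; rewrite -(uniqT U u T TP uT pu) aT => -[->].
- apply/subsetP=> e; rewrite inE => /exists_inP[v vS].
  have [T [TP /andP[vT _] _ ->]] := SP v vS.
  have /trianglesP[_ sTG] := subsetP sPG T TP.
  case/orP=> [/eqP eE|/exists_inP[u]]; first by apply: sTG; rewrite eE subD1set.
  rewrite inE => /andP[_ uT] /eqP eE; apply: sTG; rewrite eE.
  by apply/subsetP => x /set2P[] ->.
- rewrite -cardS; apply: leq_trans (card_cover_le_DT G P sPG).
  by rewrite VT_cover subset_leq_card.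
Qed.

(** * Encoding of books *)

(** What a vertex [v] records about a family of books: [None] if [v] is not an
    apex, [inl (u, w)] if it is an apex that spells out its spine [[set u; w]],
    [inr y] if it is an apex that has the same spine as [y].  Only one apex of
    each book should spell out the spine: for another one, that would mean [n^2]
    choices for only two further edges. *)
Definition code : Type := option ('I_n * 'I_n + 'I_n).

Definition leader (k : code) := if k is Some (inl _) then true else false.

Definition apexes (c : {ffun 'I_n -> code}) := [set v | isSome (c v)].
Definition leaders (c : {ffun 'I_n -> code}) := [set v | leader (c v)].

(** A reference is followed only once: it has to lead straight to the leader of
    the book. *)
Definition spine (c : {ffun 'I_n -> code}) (v : 'I_n) : {set 'I_n} :=
  let pair k := if k is Some (inl p) then [set p.1; p.2] else set0 in
  if c v is Some (inr y) then pair (c y) else pair (c v).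

(** [rep B] singles out one apex with spine [B], which becomes the leader of its
    book. *)
Lemma spine_family_code S b : spine_family S b ->
  exists c, [/\ apexes c = S, {in S, spine c =1 b} & #|leaders c| = #|b @: S|].
Proof.
move=> bS.
pose rep B := [pick y in S | b y == B].
have repP v : v \in S -> exists y, [/\ rep (b v) = Some y, y \in S & b y = b v].
  move=> vS; rewrite /rep; case: pickP => [y /andP[yS /eqP eb]|/(_ v)].
    by exists y.
  by rewrite vS eqxx.
pose ends v := odflt (v, v) [pick x : 'I_n * 'I_n | b v == [set x.1; x.2]].
have endsP v : v \in S -> b v = [set (ends v).1; (ends v).2].
  case/bS=> /eqP/cards2P[x [y [_ eb]]] _; rewrite /ends.
  case: pickP => [p /eqP ->|/(_ (x, y))] //.
  by rewrite eb eqxx.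
pose c := [ffun v : 'I_n => if v \in S then
    if rep (b v) == Some v then Some (inl (ends v))
    else Some (inr (odflt v (rep (b v))))
  else None : code].
have leadE : leaders c = [set v in S | rep (b v) == Some v].
  by apply/setP=> v; rewrite !inE ffunE; case: ifP => //= vS; case: ifP.
exists c; split.
- by apply/setP=> v; rewrite inE ffunE; case: ifP => //= vS; case: ifP.
- move=> v vS; rewrite /spine !ffunE vS.
  have [y [ry yS eb]] := repP v vS.
  case: ifP => [_|_]; first by rewrite (endsP v vS).
  by rewrite ry /= ffunE yS eb ry eqxx -eb (endsP y yS).
rewrite leadE -(card_in_imset (f := b)); last first.
  move=> v w; rewrite !inE => /andP[_ /eqP rv] /andP[_ /eqP rw] evw.
  by move: rv; rewrite evw rw => -[].
congr #|pred_of_set _|; apply/setP=> B; apply/imsetP/imsetP => -[v].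
  by rewrite inE => /andP[vS _] ->; exists v.
move=> vS ->; have [y [ry yS eb]] := repP v vS; exists y => //.
by rewrite inE yS eb ry eqxx.
Qed.

Lemma eq_books S b b' : {in S, b =1 b'} -> books S b = books S b'.
Proof.
move=> eb; apply/setP=> e; rewrite !inE; apply: eq_existsb => v.
by case: (boolP (v \in S)) => //= vS; rewrite eb.
Qed.

(** The last bound is the source of the constant 1/6: each apex costs a factor
    [1/n], and apart from at most [DT G] of them it yields only two vertices,
    while a disjoint triangle yields three; and [1/2 - 1/3 = 1/6]. *)
Lemma exists_code_books G : exists c,
  [/\ books (apexes c) (spine c) \subset G,
      2 * #|apexes c| + #|leaders c| <= #|books (apexes c) (spine c)| &
      VT G <= 2 * #|apexes c| + DT G].
Proof.
have [S [b [bS sG leVT]]] := exists_books G.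
have [c [apE spE ldE]] := spine_family_code S b bS.
by exists c; rewrite apE (eq_books _ _ _ spE) ldE; split => //; apply: card_books.
Qed.

End Combinatorics.

Arguments books {n} S b.
Arguments leader {n} k.
Arguments apexes {n} c.
Arguments leaders {n} c.
Arguments spine {n} c v.

(** * Few triangles cover many vertices: upper bound *)

Section UpperBound.
Variables (R : realType) (n : nat) (p : R).
Hypothesis p01 : 0 <= p <= 1.

Lemma Gnp_mass_ge0 (G : graph n) : 0 <= Gnp_mass p G.
Proof.
have /andP[p0 p1] := p01.
by apply: prodr_ge0 => e _; case: ifP; rewrite ?subr_ge0.
Qed.

Lemma Gnp_prob_le (A B : {set graph n}) : A \subset B -> Gnp_prob p A <= Gnp_prob p B.
Proof.
move=> /subsetP sAB; rewrite /Gnp_prob [leLHS]big_mkcond [leRHS]big_mkcond /=.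
apply: ler_sum => G _; case: ifP => [/sAB-> //|_].
by case: ifP => _ //; exact: Gnp_mass_ge0.
Qed.

Lemma Gnp_prob_superset (F : graph n) :
  Gnp_prob p [set G : graph n | F \subset G] = p ^+ #|F|.
Proof.
have d0 : [disjoint F & (set0 : graph n)] by rewrite -setI_eq0 setI0.
have := Gnp_prob_indep p d0; rewrite cards0 expr0 mulr1 => <-.
by congr Gnp_prob; apply/setP=> G; rewrite !inE -setI_eq0 set0I eqxx andbT.
Qed.

Lemma Gnp_prob_union (I : finType) (Q : pred I) (E : I -> {set graph n})
    (A : {set graph n}) :
  (forall G, G \in A -> exists2 i, Q i & G \in E i) ->
  Gnp_prob p A <= \sum_(i | Q i) Gnp_prob p (E i).
Proof.
move=> cov; rewrite /Gnp_prob.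
under [leRHS]eq_bigr do rewrite big_mkcond.
rewrite exchange_big /= [leLHS]big_mkcond /=; apply: ler_sum => G _.
case: ifP => [/cov[i Qi GE]|_].
  rewrite (bigD1 i) //= GE ler_wpDr //.
  by apply: sumr_ge0 => j _; case: ifP => // _; exact: Gnp_mass_ge0.
by apply: sumr_ge0 => j _; case: ifP => // _; exact: Gnp_mass_ge0.
Qed.

(** Union bound over the codes.  Giving each leader the weight [n p^3] and each
    other apex the weight [n p^2], the weight of a code is the probability of its
    books times [n] to the number of apexes.  The sum of all the weights is a
    product over the vertices; there are [n^2] ways to be a leader and [n] ways
    to be another apex, hence the two terms besides 1.  The quantity [B] plays
    the role of [n^t], where [t] is a lower bound, maybe not an integer, for
    the number of apexes. *)
Lemma Gnp_prob_books_le (A : {set graph n}) (B : R) : 0 <= B ->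
  (forall G, G \in A -> exists c : {ffun 'I_n -> code n},
    [/\ books (apexes c) (spine c) \subset G,
        (2 * #|apexes c| + #|leaders c| <= #|books (apexes c) (spine c)|)%N
      & B <= n%:R ^+ #|apexes c|]) ->
  Gnp_prob p A * B <= (1 + (n%:R * p) ^+ 2 + (n%:R * p) ^+ 3) ^+ n.
Proof.
move=> B0 cov; have /andP[p0 p1] := p01.
pose w (k : code n) : R := match k with
  None => 1 | Some (inl _) => n%:R * p ^+ 3 | Some (inr _) => n%:R * p ^+ 2 end.
have w0 k : 0 <= w k by case: k => [[]|] //= _; rewrite mulr_ge0 ?exprn_ge0 ?ler0n.
pose good (c : {ffun 'I_n -> code n}) :=
  (2 * #|apexes c| + #|leaders c| <= #|books (apexes c) (spine c)|)%N
  && (B <= n%:R ^+ #|apexes c|).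
have wE (c : {ffun 'I_n -> code n}) : \prod_v w (c v) =
    p ^+ (2 * #|apexes c| + #|leaders c|) * n%:R ^+ #|apexes c|.
  rewrite exprD exprM -!prodr_const.
  rewrite [X in X * _ * _]big_mkcond [X in _ * X * _]big_mkcond.
  rewrite [X in _ * X]big_mkcond.
  rewrite -!big_split /=; apply: eq_bigr => v _; rewrite !inE.
  by case: (c v) => [[]|] /= *; ring.
have -> : (1 + (n%:R * p) ^+ 2 + (n%:R * p) ^+ 3) ^+ n =
    \sum_(c : {ffun 'I_n -> code n}) \prod_v w (c v).
  rewrite -(bigA_distr_bigA (fun _ : 'I_n => w)) /= prodr_const card_ord.
  congr (_ ^+ n).
  rewrite (bigD1 None) //= (reindex_omap Some id) => [|[]] //=.
  rewrite (eq_bigl predT) => [|k]; last by rewrite eqxx.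
  rewrite big_sumType /= !sumr_const card_prod card_ord.
  rewrite -[_ *+ (n * n)]mulr_natr -[X in _ + (_ + X)]mulr_natr natrM; ring.
apply: (@le_trans _ _ (\sum_(c | good c) \prod_v w (c v))); last first.
  rewrite [leLHS]big_mkcond; apply: ler_sum => c _; case: ifP => // _.
  exact: prodr_ge0.
have /le_trans/(_ _)-> // : Gnp_prob p A * B <=
    (\sum_(c | good c) p ^+ #|books (apexes c) (spine c)|) * B.
  rewrite ler_wpM2r //.
  rewrite -(eq_bigr _ (fun c _ => Gnp_prob_superset (books (apexes c) (spine c)))).
  apply: Gnp_prob_union => G /cov[c [cG card_c leB]].
  by exists c; rewrite ?inE // /good card_c.
rewrite mulr_suml; apply: ler_sum => c /andP[card_c leB]; rewrite wE.
by apply: ler_pM; rewrite ?exprn_ge0 // ler_wiXn2l.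
Qed.
End UpperBound.

(** * Packings of disjoint triangles: lower bound *)

Section Packings.
Local Open Scope nat_scope.
Variables (n m : nat) (le_3m_n : 3 * m <= n).
Implicit Types s : 'S_m * 'S_m.

Fact slot_subproof (j : 'I_3) (i : 'I_m) : j * m + i < n.
Proof. by apply: leq_trans le_3m_n; have := ltn_ord j; have := ltn_ord i; nia. Qed.

(** The vertices are arranged in three consecutive blocks of size [m], indexed by
    [j]; the vertices from [3 m] on stay isolated. *)
Definition slot j i : 'I_n := Ordinal (slot_subproof j i).

Lemma slot_inj j i j' i' : slot j i = slot j' i' -> j = j' /\ i = i'.
Proof.
move/(congr1 val) => /= E; have m0 : 0 < m by apply: leq_trans (ltn_ord i).
split; apply: val_inj => /=.
  by move/(congr1 (divn ^~ m)): E; rewrite !divnMDl // !divn_small // !addn0.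
by move/(congr1 (modn ^~ m)): E; rewrite !modnMDl !modn_small.
Qed.

(** The first block is not permuted: this fixes the numbering of the triangles,
    without which a graph would arise from [m!] triples of permutations. *)
Definition relabel s (j : 'I_3) : 'S_m := nth 1%g [:: 1%g; s.1; s.2] j.

Definition packed_triangle s i : {set 'I_n} := [set slot j (relabel s j i) | j : 'I_3].

Definition packing s : graph n :=
  [set e : edge n | [exists i, val e \subset packed_triangle s i]].

Lemma card_packed_triangle s i : #|packed_triangle s i| = 3.
Proof. by rewrite card_imset ?card_ord // => j j' /slot_inj[]. Qed.

Lemma VT_packing s : 3 * m <= VT (packing s).
Proof.
have <- : #|[set slot x.1 x.2 | x : 'I_3 * 'I_m]| = 3 * m.
  rewrite card_imset ?card_prod ?card_ord //.
  by move=> [j i] [j' i'] /slot_inj /= [-> ->].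
apply/subset_leq_card/subsetP=> _ /imsetP[[j i] _ ->]; rewrite inE /=.
apply/exists_inP; exists (packed_triangle s ((relabel s j)^-1%g i)).
  apply/trianglesP; split=> [|e sT]; first exact: card_packed_triangle.
  by rewrite inE; apply/existsP; eexists; exact: sT.
by apply/imsetP; exists j; rewrite // permKV.
Qed.

Lemma card_packing s : #|packing s| <= 3 * m.
Proof.
rewrite -(card_imset _ val_inj).
pose E i := [set A : {set 'I_n} | A \subset packed_triangle s i & #|A| == 2].
have sub : [set val e | e in packing s] \subset \bigcup_i E i.
  apply/subsetP=> _ /imsetP[e + ->]; rewrite inE => /existsP[i sT].
  by apply/bigcupP; exists i; rewrite // inE sT (valP e).
apply: leq_trans (subset_leq_card sub) _.
rewrite -[X in 3 * X]card_ord mulnC -sum_nat_const.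
elim/big_rec2: _ => [|i k U _ IH]; first by rewrite cards0.
by rewrite (leq_trans (leq_card_setU _ _)) // leq_add // cards_draws
  card_packed_triangle.
Qed.

(** The edge that leaves the [i]-th vertex of the first block towards block [j]
    reveals the value at [i] of the [j]-th permutation. *)
Lemma packing_inj : injective packing.
Proof.
move=> s s' E.
have relE j i : relabel s j i = relabel s' j i.
  case: (eqVneq j ord0) => [->|j0]; first by [].
  have neq : slot ord0 i != slot j (relabel s j i).
    by apply: contra j0 => /eqP/slot_inj[<- _].
  have c2 : #|[set slot ord0 i; slot j (relabel s j i)]| == 2 by rewrite cards2 neq.
  pose e : edge n := exist (fun e : {set 'I_n} => #|e| == 2) _ c2.
  have : e \in packing s'.
    rewrite -E inE; apply/existsP; exists i; apply/subsetP=> x /set2P[]->.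
      by apply/imsetP; exists ord0; rewrite // perm1.
    by apply/imsetP; exists j.
  rewrite inE /= => /existsP[i' /subsetP sT].
  have /imsetP[j0' _ /slot_inj[<-]] := sT _ (set21 _ _); rewrite perm1 => ii'.
  by have /imsetP[j1 _ /slot_inj[<-]] := sT _ (set22 _ _); rewrite -ii'.
case: s s' E relE => [s1 s2] [t1 t2] E relE; congr pair; apply/permP => i.
  exact: (relE (Ordinal (isT : 1 < 3)) i).
exact: (relE (Ordinal (isT : 2 < 3)) i).
Qed.

End Packings.

Section LowerBound.
Variables (R : realType) (n : nat) (p : R).
Hypothesis p01 : 0 <= p <= 1.

Lemma card_edge : (#|{: edge n}| <= n ^ 2)%N.
Proof.
rewrite card_sig; have := card_draws 'I_n 2; rewrite cardsE card_ord => ->.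
by rewrite bin2 -mulnn -divn2 (leq_trans (leq_div _ _)) // leq_mul ?leq_pred.
Qed.

(** The crude exponent [n ^ 2] suffices: when [p] is of order [1/n], the factor
    [(1 - p) ^+ (n ^ 2)] is only exponentially small in [n]. *)
Lemma Gnp_mass_ge (G : graph n) k : (#|G| <= k)%N ->
  p ^+ k * (1 - p) ^+ (n ^ 2) <= Gnp_mass p G.
Proof.
move=> Gk; have /andP[p0 p1] := p01; have q0 : 0 <= 1 - p by rewrite subr_ge0.
have q1 : 1 - p <= 1 by rewrite gerBl.
rewrite /Gnp_mass (bigID (mem G)) /=.
rewrite (eq_bigr (fun=> p)) => [|e ->//].
rewrite [X in _ <= _ * X](eq_bigr (fun=> 1 - p)) => [|e /negbTE->//].
rewrite !prodr_const; apply: ler_pM; rewrite ?exprn_ge0 // ler_wiXn2l //.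
by apply: leq_trans card_edge; apply: max_card.
Qed.

(** Distinct packings are disjoint events when [G(n,p)] is required to be exactly
    the packing, so their probabilities add up. *)
Lemma Gnp_prob_VT_ge (m : nat) (x : R) : (3 * m <= n)%N -> x <= (3 * m)%:R ->
  (m`! ^ 2)%:R * (p ^+ (3 * m) * (1 - p) ^+ (n ^ 2)) <=
  Gnp_prob p [set G : graph n | x <= (VT G)%:R].
Proof.
move=> mn xm.
pose fam := [set packing n m mn s | s : 'S_m * 'S_m].
have cfam : #|fam| = (m`! ^ 2)%N.
  by rewrite card_imset ?card_prod ?card_Sn ?mulnn //; exact: packing_inj.
apply: (@le_trans _ _ (Gnp_prob p fam)); last first.
  apply: Gnp_prob_le => //; apply/subsetP=> _ /imsetP[s _ ->]; rewrite inE.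
  by rewrite (le_trans xm) // ler_nat VT_packing.
rewrite -cfam mulr_natl -sumr_const; apply: ler_sum => _ /imsetP[s _ ->].
by apply: Gnp_mass_ge; exact: card_packing.
Qed.

End LowerBound.

(** * Asymptotic estimates *)

Section Estimates.
Variable R : realType.

Lemma expR_ln_pow (x : R) k : 0 < x -> expR (k%:R * ln x) = x ^+ k.
Proof. by move=> x0; rewrite expRM_natl lnK. Qed.

(** The weak Stirling bound [m^m / m! <= e^m]: the left-hand side is a single term
    of the exponential series at [m]. *)
Lemma fact_ge (m : nat) : (0 < m)%N -> expR (m%:R * ln m%:R - m%:R) <= m`!%:R :> R.
Proof.
case: m => // k _; have x0 : 0 < k.+1%:R :> R by rewrite ltr0n.
rewrite expRB expR_ln_pow // ler_pdivrMr ?expR_gt0 // mulrC.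
rewrite -ler_pdivrMr ?ltr0n ?fact_gt0 //.
by apply: le_trans (expR_ge1Dxn k (ltW x0)); rewrite lerDr.
Qed.

Lemma expR_le_onem (p : R) : 0 <= p <= 1 / 2 -> expR (- (2 * p)) <= 1 - p.
Proof.
move=> /andP[p0 p1]; rewrite expRN -div1r ler_pdivrMr ?expR_gt0 //.
apply: (@le_trans _ _ ((1 - p) * (1 + 2 * p))); first nra.
by rewrite ler_wpM2l ?expR_ge1Dx //; lra.
Qed.

(** With [m] just above [a n / 3], the logarithm of the bound for packings is
    about [2 m ln m - 3 m ln n], and [ln m >= ln n + ln (a / 3)].  Rounding [m] up
    costs at most [ln n <= n]; that and every other term is linear in [n]. *)
Lemma Gnp_prob_VT_lower (lambda a : R) : 0 < lambda -> 0 < a -> a < 1 ->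
  exists C : R, exists N : nat, forall n : nat, (N <= n)%N ->
  expR (- (a / 3) * n%:R * ln n%:R - C * n%:R) <=
  Gnp_prob (lambda / n%:R) [set G : graph n | a * n%:R <= (VT G)%:R].
Proof.
move=> l0 a0 a1.
exists (3 + 2 * `|ln (a / 3)| + 3 * `|ln lambda| + 2 * lambda).
(* The thresholds ensure [p <= 1 / 2] and [3 m <= a n + 3 <= n]. *)
exists (maxn 1 (maxn (Num.truncn (2 * lambda)).+1 (Num.truncn (3 / (1 - a))).+1)).
move=> n; rewrite !geq_max => /and3P[n_gt0 n_l n_a].
have n0 : 0 < n%:R :> R by rewrite ltr0n.
have {}n_l : 2 * lambda < n%:R.
  by apply: lt_le_trans (truncnS_gt _) _; rewrite ler_nat.
have {n_a} : 3 / (1 - a) < n%:R.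
  by apply: lt_le_trans (truncnS_gt _) _; rewrite ler_nat.
rewrite ltr_pdivrMr ?subr_gt0 // => n_a.
set p := lambda / n%:R.
have p0 : 0 < p by rewrite divr_gt0.
have p1 : p <= 1 / 2 by rewrite ler_pdivrMr //; lra.
have p01 : 0 <= p <= 1 by apply/andP; split; lra.
pose m := (Num.truncn (a * n%:R / 3)).+1.
have an0 : 0 <= a * n%:R / 3 by rewrite divr_ge0 // mulr_ge0 // ltW.
have m_gt : a * n%:R / 3 < m%:R by apply: truncnS_gt.
have m_le : m%:R <= a * n%:R / 3 + 1.
  by have /andP[tr _] := truncn_itv an0; rewrite /m -natr1 lerD2r.
have mn : (3 * m <= n)%N by rewrite -(ler_nat R) natrM; lra.
have x3m : a * n%:R <= (3 * m)%:R by rewrite natrM; lra.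
apply: le_trans (Gnp_prob_VT_ge R n p p01 m _ mn x3m).
have m0 : 0 < m%:R :> R by rewrite ltr0n.
have fm : expR (2 * (m%:R * ln m%:R - m%:R)) <= (m`! ^ 2)%:R :> R.
  by rewrite natrX expRM_natl lerXn2r ?nnegrE ?expR_ge0 ?ler0n // fact_ge.
have pm : p ^+ (3 * m) = expR ((3 * m%:R) * (ln lambda - ln n%:R)).
  by rewrite -ln_div ?posrE // -natrM expR_ln_pow.
have qn : expR (- (2 * lambda * n%:R)) <= (1 - p) ^+ (n ^ 2).
  have -> : - (2 * lambda * n%:R) = (n ^ 2)%:R * (- (2 * p)).
    by rewrite /p natrX; field; rewrite gt_eqF.
  have p12 : 0 <= p <= 1 / 2 by rewrite ltW.
  by rewrite expRM_natl lerXn2r ?nnegrE ?expR_ge0 ?expR_le_onem //; lra.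
rewrite pm.
apply: le_trans (ler_pM _ _ fm (ler_pM _ _ (lexx _) qn)); rewrite ?mulr_ge0 ?expR_ge0 //.
rewrite -!expRD ler_expR.
have lnm : ln (a / 3) + ln n%:R <= ln m%:R.
  have a3 : 0 < a / 3 by lra.
  have an_m : a / 3 * n%:R <= m%:R by lra.
  by rewrite -lnM ?posrE // ler_ln ?posrE //; apply: mulr_gt0.
have L0 : 0 <= ln n%:R :> R by rewrite ln_ge0 // ler1n.
have Ln : ln n%:R <= n%:R :> R.
  have := le_ln1Dx (x := n%:R - 1 : R); rewrite addrCA subrr addr0.
  by move=> /(_ _)/le_trans->//; lra.
have mn' : m%:R <= n%:R :> R by lra.
have h1 : m%:R * (ln (a / 3) + ln n%:R) <= m%:R * ln m%:R by rewrite ler_pM2l.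
have absM (x : R) : - (n%:R * `|x|) <= m%:R * x.
  rewrite lerNl -mulrN; apply: le_trans (ler_wpM2l (ltW m0) (ler_norm _)) _.
  by rewrite normrN ler_wpM2r.
have h2 := absM (ln (a / 3)); have h3 := absM (ln lambda).
have h4 : m%:R * ln n%:R <= (a * n%:R / 3 + 1) * ln n%:R by rewrite ler_wpM2r.
lra.
Qed.
End Estimates.

(** * The conditional probability *)

Theorem theorem2p2 (R : realType) (lambda a : R)
  (lambda_gt0 : 0 < lambda) (a_gt0 : 0 < a) (a_lt1 : a < 1) :
  exists C : R, forall eps : R, 0 < eps ->
    exists N : nat, forall n : nat, (N <= n)%N ->
      Gnp_cond_prob (lambda / n%:R)
        [set G : graph n | (DT G)%:R <= 1 / 3 * (a - eps) * n%:R]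
        [set G : graph n | a * n%:R <= (VT G)%:R]
      <= expR (- (1 / 6) * eps * n%:R * ln (n%:R) + C * n%:R).
Proof.
have [C [N lowerB]] := Gnp_prob_VT_lower R lambda a lambda_gt0 a_gt0 a_lt1.
pose K := 1 + lambda ^+ 2 + lambda ^+ 3.
have K_gt0 : 0 < K by rewrite !addr_gt0 ?exprn_gt0.
exists (ln K + C) => eps eps_gt0.
exists (maxn N (maxn 1 (Num.truncn lambda).+1)) => n.
rewrite !geq_max => /and3P[N_n n_gt0 l_n].
have n0 : 0 < n%:R :> R by rewrite ltr0n.
set p := lambda / n%:R.
have np : n%:R * p = lambda by rewrite mulrC divfK ?gt_eqF.
have p01 : 0 <= p <= 1.
  rewrite divr_ge0 ?(ltW lambda_gt0) ?(ltW n0) //= ler_pdivrMr // mul1r ltW //.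
  by apply: lt_le_trans (truncnS_gt _) _; rewrite ler_nat.
have L0 : 0 <= ln n%:R :> R by rewrite ln_ge0 // ler1n.
set A := [set G | _ <= 1 / 3 * _ * _]; set B := [set G | _].
(* A lower bound for half of [VT G - DT G], hence for the number of apexes. *)
pose t := a / 3 * n%:R + eps / 6 * n%:R.
have upperA : Gnp_prob p (A :&: B) * expR (t * ln n%:R) <= expR (n%:R * ln K).
  rewrite expR_ln_pow // /K -np; apply: Gnp_prob_books_le; rewrite ?expR_ge0 // => G.
  rewrite !inE => /andP[DTG VTG]; have [c [cG card_c leVT]] := exists_code_books n G.
  exists c; split => //; rewrite -expR_ln_pow // ler_expR ler_wpM2r //.
  move: leVT; rewrite -(ler_nat R) natrD natrM /t; lra.
have {}lowerB := lowerB n N_n.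
rewrite /Gnp_cond_prob ler_pdivrMr ?(lt_le_trans (expR_gt0 _) lowerB) //.
apply: le_trans (ler_wpM2l (expR_ge0 _) lowerB); rewrite -expRD.
rewrite -ler_pdivlMr ?expR_gt0 // -expRB in upperA; apply: le_trans upperA _.
by rewrite ler_expR /t le_eqVlt; apply/orP; left; apply/eqP; field.
Qed.
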